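(* Let $P\in\mathrm{SpGr}(2n,2k)$ and $\Gamma\in T_P\mathrm{SpGr}(2n,2k)$. Then $$\mathcal{R}^{\mathrm{SpGr}}_P(\Gamma):=\mathrm{cay}\left(\tfrac12[\Gamma,P]\right)P\,\mathrm{cay}\left(-\tfrac12[\Gamma,P]\right)$$ defines a retraction on $\mathrm{SpGr}(2n,2k)$. For $U\in\rho^{-1}(P)\subset\mathrm{SpSt}(2n,2k)$, it fulfills $\mathcal{R}^{\mathrm{SpGr}}_P(\Gamma)=\rho\big(\mathcal{R}^{\mathrm{SpSt}}_U(\Gamma^{\mathrm{hor}}_U)\big)$. The curve $\gamma(t):=\mathcal{R}^{\mathrm{SpGr}}_P(t\Gamma)$ fulfills $$\dot\gamma(t)=\left[\tfrac12[\Gamma,P]\left(\left(I_{2n}-\tfrac t2[\Gamma,P]\right)^{-1}+\left(I_{2n}+\tfrac t2[\Gamma,P]\right)^{-1}\right),\ \gamma(t)\right].$$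
   Context: Let $k\le n$ be positive integers, $J_{2m}=\begin{bmatrix}0&I_m\\-I_m&0\end{bmatrix}$, and for a real $2a\times 2b$ matrix $A$ put $A^+:=J_{2b}^TA^TJ_{2a}$. Let $\mathfrak{sp}(2n,\mathbb{R})=\{\Omega\in\mathbb{R}^{2n\times2n}:\Omega^+=-\Omega\}$. The real symplectic Stiefel manifold is $\mathrm{SpSt}(2n,2k)=\{U\in\mathbb{R}^{2n\times2k}:U^+U=I_{2k}\}$. The real symplectic Grassmann manifold is $\mathrm{SpGr}(2n,2k)=\{P\in\mathbb{R}^{2n\times2n}: P^2=P,\ \mathrm{rank}(P)=2k,\ P^+=P\}$, with tangent space $T_P\mathrm{SpGr}(2n,2k)=\{[\Omega,P]:\Omega\in\mathfrak{sp}(2n,\mathbb{R})\}$, where $[\cdot,\cdot]$ is the matrix commutator. The map $\rho:\mathrm{SpSt}(2n,2k)\to\mathrm{SpGr}(2n,2k)$ is $\rho(U)=UU^+$; for $\Gamma\in T_P\mathrm{SpGr}(2n,2k)$ and $U\in\rho^{-1}(P)$, the horizontal lift of $\Gamma$ is $\Gamma^{\mathrm{hor}}_U=\Gamma U$. The Cayley transformation is $\mathrm{cay}(X):=(I_m+X)(I_m-X)^{-1}$, $X\in\mathbb{R}^{m\times m}$. The Cayley retraction on $\mathrm{SpSt}(2n,2k)$ is $\mathcal{R}^{\mathrm{SpSt}}_U(\Delta)=\mathrm{cay}\left(\frac12\tilde\Omega(U,\Delta)\right)U$ for $\Delta$ in the tangent space $T_U\mathrm{SpSt}(2n,2k)=\{\Delta\in\mathbb{R}^{2n\times2k}:U^+\Delta\in\mathfrak{sp}(2k,\mathbb{R})\}$,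 where $\tilde\Omega(U,\Delta)=\left(I_{2n}-\frac12UU^+\right)\Delta U^+-U\Delta^+\left(I_{2n}-\frac12UU^+\right)$. A retraction on a smooth manifold $\mathcal M$ with tangent bundle $T\mathcal M$ is a smooth mapping $R:T\mathcal M\to\mathcal M$ such that for any $x\in\mathcal M$, the restriction $R_x$ of $R$ to $T_x\mathcal M$ satisfies $R_x(0)=x$ and $\mathrm{d}(R_x)_0=\mathrm{id}$.
   Formalization: The retraction is defined only on the open neighbourhood of the zero section where both Cayley transformations exist, not on the whole tangent bundle, since I−½[Γ,P] can be singular; the lift identity and curve equation are stated for Γ, respectively tΓ, in that domain. *)

(* Defs.v *)
From HB Require Import structures.
From mathcomp Require Export all_boot all_order all_algebra.
From mathcomp Require Export all_classical all_reals all_analysis.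
Export Order.TTheory GRing.Theory Num.Theory.
Export numFieldNormedType.Exports.

Set Implicit Arguments.
Unset Strict Implicit.
Unset Printing Implicit Defensive.

Local Open Scope classical_set_scope.
Local Open Scope ring_scope.

Section Smooth.
Context {R : realType} {V W : normedModType R}.

(* Only meant for finite-dimensional V and W and an open set O: there,
   continuity of all iterated directional derivatives of order at most k
   amounts to being of class C^k on O. *)
Fixpoint of_class (k : nat) (O : set V) (f : V -> W) : Prop :=
  if k is k'.+1 then
    (forall x, O x -> differentiable f x) /\
    (forall v, of_class k' O (fun x => 'D_v f x))
  else forall x, O x -> {for x, continuous f}.

(* Smooth maps on an arbitrary subset S of V are those which locally extend to
   C^oo maps on open subsets of V. For (open subsets of) embedded submanifolds
   this is smoothness in the sense of the manifold structure. *)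
Definition smooth_on (S : set V) (f : V -> W) : Prop :=
  forall x, S x -> exists O : set V, exists F : V -> W,
    [/\ open O, O x, forall k, of_class k O F
      & forall y, S y -> O y -> F y = f y].

(* df is the Frechet differential at 0 of the restriction of f to the linear
   subspace T of V; only the values of f on T near 0 matter. *)
Definition has_diff0_on (T : set V) (f df : V -> W) : Prop :=
  forall e : R, 0 < e ->
    \forall v \near within T (nbhs 0), `|f v - f 0 - df v| <= e * `|v|.

End Smooth.

Section Retraction.
Context {R : realType} {V : normedModType R}.

Definition tangent_bundle (M : set V) (T : V -> set V) : set (V * V) :=
  [set xv | M xv.1 /\ T xv.1 xv.2].

(* M is a submanifold of V, with tangent spaces T x. The map Rt is considered
   on a set D of tangent vectors, which has to be a relatively open
   neighbourhood of the zero section of the tangent bundle. *)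
Definition is_retraction (M : set V) (T : V -> set V) (D : set (V * V))
    (Rt : V -> V -> V) : Prop :=
  [/\ (exists2 O : set (V * V), open O & D = tangent_bundle M T `&` O),
      (forall x, M x -> D (x, 0)),
      smooth_on D (fun xv => Rt xv.1 xv.2),
      (forall x v, D (x, v) -> M (Rt x v))
    & forall x, M x -> Rt x 0 = x /\ has_diff0_on (T x) (Rt x) (fun v => v)].

End Retraction.

(* The size 2m is written m + m throughout. *)
Section Symplectic.
Context {R : realType}.

Definition sympJ (m : nat) : 'M[R]_(m + m) := block_mx 0 1%:M (- 1%:M) 0.

Definition spadj (a b : nat) (A : 'M[R]_(a + a, b + b)) : 'M[R]_(b + b, a + a) :=
  (sympJ b)^T *m A^T *m sympJ a.

Definition lie (m : nat) (A B : 'M[R]_m) : 'M[R]_m := A *m B - B *m A.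

Definition spLie (n : nat) : set 'M[R]_(n + n) := [set Om | spadj Om = - Om].
Arguments spLie n : clear implicits.

Definition SpSt (n k : nat) : set 'M[R]_(n + n, k + k) :=
  [set U | spadj U *m U = 1%:M].
Arguments SpSt n k : clear implicits.

Definition TSpSt (n k : nat) (U : 'M[R]_(n + n, k + k)) :
    set 'M[R]_(n + n, k + k) :=
  [set Delta | spLie k (spadj U *m Delta)].

Definition SpGr (n k : nat) : set 'M[R]_(n + n) :=
  [set P | [/\ P *m P = P, \rank P = (2 * k)%N & spadj P = P]].
Arguments SpGr n k : clear implicits.

Definition TSpGr (n : nat) (P : 'M[R]_(n + n)) : set 'M[R]_(n + n) :=
  [set Gamma | exists2 Om, spLie n Om & Gamma = lie Om P].

Definition rho (n k : nat) (U : 'M[R]_(n + n, k + k)) : 'M[R]_(n + n) :=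
  U *m spadj U.

Definition hor_lift (n k : nat) (Gamma : 'M[R]_(n + n))
    (U : 'M[R]_(n + n, k + k)) : 'M[R]_(n + n, k + k) :=
  Gamma *m U.

(* invmx is total, so the Cayley transformation is only meaningful at those X
   which satisfy cay_defined. *)
Definition cay_defined (m : nat) (X : 'M[R]_m) : bool := 1%:M - X \in unitmx.

Definition cay (m : nat) (X : 'M[R]_m) : 'M[R]_m :=
  (1%:M + X) *m invmx (1%:M - X).

Definition tildeOmega (n k : nat) (U Delta : 'M[R]_(n + n, k + k)) :
    'M[R]_(n + n) :=
  (1%:M - 2^-1 *: (U *m spadj U)) *m Delta *m spadj U
  - U *m spadj Delta *m (1%:M - 2^-1 *: (U *m spadj U)).

Definition retr_SpSt (n k : nat) (U Delta : 'M[R]_(n + n, k + k)) :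
    'M[R]_(n + n, k + k) :=
  cay (2^-1 *: tildeOmega U Delta) *m U.

Definition retr_SpSt_dom (n k : nat) :
    set ('M[R]_(n + n, k + k) * 'M[R]_(n + n, k + k)) :=
  [set UD | tangent_bundle (SpSt n k) (@TSpSt n k) UD /\
            cay_defined (2^-1 *: tildeOmega UD.1 UD.2)].
Arguments retr_SpSt_dom n k : clear implicits.

Definition retr_SpGr (n : nat) (P Gamma : 'M[R]_(n + n)) : 'M[R]_(n + n) :=
  cay (2^-1 *: lie Gamma P) *m P *m cay (- (2^-1 *: lie Gamma P)).

Definition retr_SpGr_dom (n k : nat) : set ('M[R]_(n + n) * 'M[R]_(n + n)) :=
  [set PG | [/\ tangent_bundle (SpGr n k) (@TSpGr n) PG,
                cay_defined (2^-1 *: lie PG.2 PG.1)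
              & cay_defined (- (2^-1 *: lie PG.2 PG.1))]].
Arguments retr_SpGr_dom n k : clear implicits.

End Symplectic.

Arguments spLie {R} n.
Arguments SpSt {R} n k.
Arguments SpGr {R} n k.
Arguments retr_SpSt_dom {R} n k.
Arguments retr_SpGr_dom {R} n k.

(* Main.v *)
From HB Require Import structures.
Require Import Defs.

(** Put X := [Gamma, P] / 2. For a tangent vector Gamma = [Omega, P] at P one
    has Gamma^+ = Gamma, hence X^+ = - X, so that C := cay X is symplectic:
    C^+ = cay (- X) = C^-1 ([spadj_cay], [cay_mulVr]). The map
    R_P (Gamma) = C P C^+ is therefore a conjugation by a symplectic matrix,
    which preserves idempotency, the rank and self-adjointness ([SpGr_conj]).
    If P = U U^+, then the operator tildeOmega (U, Gamma U) is [Gamma, P], and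
    C P C^+ = (C U) (C U)^+ is the image under rho of the retraction upstairs.

    All the analysis goes through the identity cay X = 2 (1 - X)^-1 - 1
    ([cayE]), in which X occurs only once. Matrix inversion is
    differentiable because it is given by Cramer's rule, and differentiating
    A A^-1 = 1 yields D (A^-1) = - A^-1 (D A) A^-1 ([diff_invmx]). This formula
    expresses the derivative by the inverse itself, so inversion is of class
    C^k for all k by induction ([of_class_invmx]); together with the product
    rule for matrices this makes R smooth on the open set where both Cayley
    transformations are defined. It also gives
    D (cay X) = 2 N (D X) N with N = (1 - X)^-1 ([diff_cay]).

    At Gamma = 0 the derivative of R_P in the direction V is hence
    [[V, P], P], and the square of ad_P is the identity on the tangent space
    at P ([TSpGr_lieK]), so that this derivative is the identity. Along the curve
    t |-> t Gamma, both Cayley factors commute with Y := [Gamma, P] / 2. With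
    N := (1 - t Y)^-1, M := (1 + t Y)^-1 and A := Y (N + M) one gets
    2 N Y N = A cay (t Y) ([mul_cay]) and 2 M Y M = cay (- t Y) A ([cay_mul]),
    so the product rule turns the derivative of the curve into the commutator
    of A with it. *)

Set Implicit Arguments.
Unset Strict Implicit.
Unset Printing Implicit Defensive.

Local Open Scope classical_set_scope.
Local Open Scope ring_scope.

(** * Closure properties of maps of class C^k *)

Section Smooth.
Context {R : realType}.
Implicit Types U V W Z : normedModType R.

Lemma near_eq_differentiable {V W} (f g : V -> W) x :
  (\near x, f x = g x) -> differentiable f x -> differentiable g x.
Proof.
move=> fg df.
have gE : g \o shift x = cst (g x) + 'd f x +o_ 0 id.
  apply/eqaddoP => e e0; have /eqaddoP/(_ e e0) := diff_locally df.
  rewrite -(nbhs_singleton fg); move: fg; rewrite (near_shift 0 x) subr0.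
  rewrite /= => fg; apply: filterS2 fg => h /=.
  by rewrite !fctE /= => ->; exact: id.
have cf : continuous ('d f x) by exact: diff_continuous.
by apply/diff_locallyP; rewrite (diff_unique cf gE).
Qed.

Lemma near_open {V} (O : set V) (P : V -> Prop) x :
  open O -> O x -> (forall y, O y -> P y) -> \forall y \near x, P y.
Proof. by move=> oO Ox OP; apply: filterS OP _; exact: open_nbhs_nbhs. Qed.

(** The rules for the derivatives of sums, products and inverses are equalities
    on O only, so the induction on k has to replace functions that agree just
    on O. *)
Lemma of_class_ext {V W} k (O : set V) (f g : V -> W) : open O ->
  (forall x, O x -> f x = g x) -> of_class k O f -> of_class k O g.
Proof.
move=> oO; elim: k f g => [|k IH] f g fg /=.
  move=> fc x Ox; rewrite /continuous_at /prop_for -(fg x Ox).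
  apply: cvg_trans (fc x Ox); apply: near_eq_cvg.
  exact: (near_open oO Ox fg).
move=> [df Df]; split=> [x Ox|v].
  exact: near_eq_differentiable (near_open oO Ox fg) (df x Ox).
apply: IH (Df v) => x Ox.
exact/near_eq_derive/(near_open oO Ox).
Qed.

Lemma of_classW {V W} k (O : set V) (f : V -> W) :
  of_class k.+1 O f -> of_class k O f.
Proof.
elim: k f => [|k IH] f [df Df].
  by move=> x /df/differentiable_continuous.
by split=> // v; exact/IH/Df.
Qed.

Lemma of_class_cst {V W} k (O : set V) (a : W) : of_class k O (cst a).
Proof.
elim: k a => [|k IH] a /=; first by move=> x _; exact: cvg_cst.
split=> [x _|v]; first exact: differentiable_cst.
by rewrite (_ : (fun x => _) = cst 0) //; apply/funext => x; rewrite derive_cst.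
Qed.

Lemma of_class_linear {V W} k (O : set V) (L : {linear V -> W}) :
  continuous L -> of_class k O L.
Proof.
move=> cL; case: k => [|k] /=; first by move=> x _; exact: cL.
split=> [x _|v]; first exact: linear_differentiable.
rewrite (_ : (fun x => _) = cst (L v)); first exact: of_class_cst.
apply/funext => x; rewrite deriveE ?diff_lin //.
exact: linear_differentiable.
Qed.

Lemma of_classD {V W} k (O : set V) (f g : V -> W) : open O ->
  of_class k O f -> of_class k O g -> of_class k O (f + g).
Proof.
move=> oO; elim: k f g => [|k IH] f g /=.
  by move=> cf cg x Ox; apply: continuousD; [exact: cf|exact: cg].
move=> [df Df] [dg Dg]; split=> [x Ox|v].
  by apply: differentiableD; [exact: df|exact: dg].
apply: of_class_ext (IH _ _ (Df v) (Dg v)) => // x Ox.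
by rewrite deriveD //; apply: diff_derivable; [exact: df|exact: dg].
Qed.

Lemma of_classZ {V W} k (O : set V) (c : R) (f : V -> W) :
  open O -> of_class k O f -> of_class k O (fun y => c *: f y).
Proof.
move=> oO; elim: k f => [|k IH] f /=.
  by move=> cf x Ox; apply: continuousZl_tmp; exact: cf.
move=> [df Df]; split=> [x Ox|v].
  by apply: differentiableZ; exact: df.
apply: of_class_ext (IH _ (Df v)) => // x Ox.
by rewrite deriveZ //; apply: diff_derivable; exact: df.
Qed.

Lemma of_classN {V W} k (O : set V) (f : V -> W) : open O ->
  of_class k O f -> of_class k O (fun y => - f y).
Proof.
move=> oO Cf; apply: of_class_ext (of_classZ (-1) oO Cf) => // x _.
by rewrite scaleN1r.
Qed.

Lemma diff_bilinear {U V W Z} (B : {bilinear V -> W -> Z}) (f : U -> V)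
    (g : U -> W) x : continuous (fun p => B p.1 p.2) ->
  differentiable f x -> differentiable g x ->
  differentiable (fun y => B (f y) (g y)) x /\
  forall v, 'D_v (fun y => B (f y) (g y)) x =
            B (f x) ('D_v g x) + B ('D_v f x) (g x).
Proof.
move=> cB df dg; pose b := fun p : V * W => B p.1 p.2.
pose h := fun y => (f y, g y).
have dh : differentiable h x by exact: differentiable_pair.
have db : differentiable b (h x) by exact: differentiable_bilin.
have dbh : differentiable (b \o h) x by exact: differentiable_comp.
split=> // v; rewrite (deriveE (f := b \o h)) // (diff_comp dh db) /=.
by rewrite diff_bilin // diff_pair //= !deriveE.
Qed.

(** By the product rule each derivative is a sum of two terms of the same shape
    in which one of the factors is of class C^k and the other one is the
    derivative of a map of class C^(k+1): induct on k for both at once. *)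
Lemma of_class_bilinear {U V W Z} (B : {bilinear V -> W -> Z}) k (O : set U)
    (f : U -> V) (g : U -> W) : open O -> continuous (fun p => B p.1 p.2) ->
  of_class k O f -> of_class k O g -> of_class k O (fun y => B (f y) (g y)).
Proof.
move=> oO cB; elim: k f g => [|k IH] f g.
  move=> cf cg x Ox; apply: (@continuous_comp _ _ _ (fun y => (f y, g y))
    (fun p => B p.1 p.2)) => //; last exact: cB.
  by apply: cvg_pair; [exact: cf|exact: cg].
move=> Cf Cg; have [df Df] := Cf; have [dg Dg] := Cg.
split=> [x Ox|v].
  by have [] := diff_bilinear cB (df x Ox) (dg x Ox).
apply: of_class_ext (of_classD oO (IH _ _ (of_classW Cf) (Dg v))
  (IH _ _ (Df v) (of_classW Cg))) => // x Ox.
by have [_ ->] := diff_bilinear cB (df x Ox) (dg x Ox).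
Qed.

Lemma has_diff0_on_derive {V W} (T : set V) (f df : V -> W) :
  differentiable f 0 -> (forall v, T v -> 'D_v f 0 = df v) ->
  has_diff0_on T f df.
Proof.
move=> dif Df e e0; have /eqaddoP/(_ e e0) := diff_locally dif.
apply: filterS => v /= + Tv; rewrite -Df // deriveE //.
by rewrite !fctE /= addr0 opprD addrA.
Qed.

End Smooth.

(** * Differential calculus of matrix-valued maps *)

Section MatrixCalculus.
Context {R : realType}.
Implicit Types V W : normedModType R.

Lemma differentiable_mx {V} m n (f : V -> 'M[R]_(m, n)) x :
  (forall i j, differentiable (fun y => f y i j) x) -> differentiable f x.
Proof.
move=> df.
(* f is the finite sum of its entries times the constant matrices E_ij. *)
have -> : f = \sum_i \sum_j (fun y => f y i j *: delta_mx i j).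
  apply/funext => y; rewrite fct_sumE [LHS]matrix_sum_delta.
  by apply: eq_bigr => i _; rewrite fct_sumE.
apply: differentiable_sum => i; apply: differentiable_sum => j.
exact: differentiableZl.
Qed.

Lemma differentiable_entry {V} m n (f : V -> 'M[R]_(m, n)) i j x :
  differentiable f x -> differentiable (fun y => f y i j) x.
Proof.
pose c (N : 'M[R]_(m, n)) : R := N i j.
move=> df; apply: (@differentiable_comp _ _ _ _ f c) => //.
exact: differentiable_coord.
Qed.

Lemma differentiable_bigsum {V} (I : Type) (r : seq I) (F : I -> V -> R) x :
  (forall i, differentiable (F i) x) ->
  differentiable (fun y => \sum_(i <- r) F i y) x.
Proof.
move=> dF; elim: r => [|i r IH].
  under eq_fun do rewrite big_nil.
  exact: differentiable_cst.
under eq_fun do rewrite big_cons.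
exact: differentiableD.
Qed.

Lemma differentiable_bigprod {V} (I : Type) (r : seq I) (F : I -> V -> R) x :
  (forall i, differentiable (F i) x) ->
  differentiable (fun y => \prod_(i <- r) F i y) x.
Proof.
move=> dF; elim: r => [|i r IH].
  under eq_fun do rewrite big_nil.
  exact: differentiable_cst.
under eq_fun do rewrite big_cons.
exact: differentiableM.
Qed.

Lemma differentiable_det {V} n (f : V -> 'M[R]_n) x :
  (forall i j, differentiable (fun y => f y i j) x) ->
  differentiable (fun y => \det (f y)) x.
Proof.
move=> df; apply: differentiable_bigsum => s.
by apply: differentiableM => //; exact: differentiable_bigprod.
Qed.

Lemma differentiable_adj {V} n (f : V -> 'M[R]_n) x :
  differentiable f x -> differentiable (fun y => \adj (f y)) x.
Proof.
move=> df; apply: differentiable_mx => i j.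
under eq_fun do rewrite mxE.
apply: differentiableM => //; apply: differentiable_det => k l.
under eq_fun do rewrite !mxE.
exact: differentiable_entry.
Qed.

Lemma open_unitmx n : open [set A : 'M[R]_n | A \in unitmx].
Proof.
rewrite (_ : mkset _ = (fun A : 'M[R]_n => \det A) @^-1` [set r | r != 0]).
  apply: open_comp; last exact: open_neq.
  move=> A _; apply: differentiable_continuous.
  apply: (differentiable_det (f := id)) => i j.
  exact: differentiable_coord.
by apply/seteqP; split=> A /=; rewrite unitmxE unitfE.
Qed.

Lemma continuous_mulmx m n p :
  continuous (fun AB : 'M[R]_(m, n) * 'M[R]_(n, p) => AB.1 *m AB.2).
Proof.
move=> AB; apply: differentiable_continuous; apply: differentiable_mx => i j.
under eq_fun do rewrite mxE.
have d1 : differentiable (fst : 'M[R]_(m, n) * 'M[R]_(n, p) -> _) AB.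
  by apply: linear_differentiable => x; exact: cvg_fst.
have d2 : differentiable (snd : 'M[R]_(m, n) * 'M[R]_(n, p) -> _) AB.
  by apply: linear_differentiable => x; exact: cvg_snd.
apply: differentiable_bigsum => k.
by apply: differentiableM; apply: differentiable_entry.
Qed.

Lemma diff_mulmx {V} m n p (f : V -> 'M[R]_(m, n)) (g : V -> 'M[R]_(n, p)) x :
  differentiable f x -> differentiable g x ->
  differentiable (fun y => f y *m g y) x /\
  forall v, 'D_v (fun y => f y *m g y) x =
            f x *m 'D_v g x + 'D_v f x *m g x.
Proof.
pose B : {bilinear 'M[R]_(m, n) -> 'M[R]_(n, p) -> 'M[R]_(m, p)} :=
  @mulmx R m n p.
exact: (@diff_bilinear R V _ _ _ B f g x (@continuous_mulmx m n p)).
Qed.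

Lemma of_class_mulmx {V} m n p k (O : set V) (f : V -> 'M[R]_(m, n))
    (g : V -> 'M[R]_(n, p)) : open O ->
  of_class k O f -> of_class k O g -> of_class k O (fun y => f y *m g y).
Proof.
move=> oO.
pose B : {bilinear 'M[R]_(m, n) -> 'M[R]_(n, p) -> 'M[R]_(m, p)} :=
  @mulmx R m n p.
exact: (@of_class_bilinear R V _ _ _ B k O f g oO (@continuous_mulmx m n p)).
Qed.

(** Cramer's rule shows that the inverse is differentiable; the derivative is
    then forced by the product rule. *)
Lemma diff_invmx {V} n (f : V -> 'M[R]_n) x :
  differentiable f x -> f x \in unitmx ->
  differentiable (fun y => invmx (f y)) x /\
  forall v, 'D_v (fun y => invmx (f y)) x =
            - (invmx (f x) *m 'D_v f x *m invmx (f x)).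
Proof.
move=> df fxu.
have nu : \forall y \near x, f y \in unitmx.
  have cf := differentiable_continuous df.
  exact: cf (open_nbhs_nbhs (conj (@open_unitmx n) fxu)).
have di : differentiable (fun y => invmx (f y)) x.
  apply: (near_eq_differentiable (f := fun y => (\det (f y))^-1 *: \adj (f y))).
    by apply: filterS nu => y fyu; rewrite /invmx fyu.
  apply: differentiable_mx => i j.
  under eq_fun do rewrite mxE.
  apply: differentiableM.
    apply: differentiableV; last by rewrite -unitfE -unitmxE.
    by apply: differentiable_det => k l; exact: differentiable_entry.
  by apply: differentiable_entry; exact: differentiable_adj.
split=> // v; have [_ /(_ v) D1] := diff_mulmx df di.
(* Differentiate f * f^-1 = 1, which holds near x. *)
have D0 : 'D_v (fun y => f y *m invmx (f y)) x = 0.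
  rewrite -[RHS](derive_cst (1%:M : 'M[R]_n) x v); apply: near_eq_derive.
  by apply: filterS nu => y fyu; rewrite mulmxV.
move: D1; rewrite D0 => /esym/eqP; rewrite addr_eq0 => /eqP.
move=> /(congr1 (mulmx (invmx (f x)))).
by rewrite mulKmx // mulmxN mulmxA.
Qed.

(** The derivative - f^-1 (D f) f^-1 involves only f^-1 and D f, whence the
    induction on k. *)
Lemma of_class_invmx {V} n k (O : set V) (f : V -> 'M[R]_n) : open O ->
  (forall x, O x -> f x \in unitmx) ->
  of_class k O f -> of_class k O (fun y => invmx (f y)).
Proof.
move=> oO fu; elim: k => [|k IH] Cf.
  move=> x Ox; apply: (@continuous_comp _ _ _ f (@invmx R n)); first exact: Cf.
  apply: differentiable_continuous.
  by have [] := diff_invmx (V := 'M[R]_n) (f := id) _ (fu x Ox).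
have [df Df] := Cf; have Ci := IH (of_classW Cf).
split=> [x Ox|v]; first by have [] := diff_invmx (df x Ox) (fu x Ox).
have CiD := of_class_mulmx oO (of_class_mulmx oO Ci (Df v)) Ci.
apply: of_class_ext (of_classN oO CiD) => // x Ox.
by have [_ ->] := diff_invmx (df x Ox) (fu x Ox).
Qed.

End MatrixCalculus.

(** * The Cayley transformation *)

Section Cayley.
Context {R : realType}.
Implicit Types V : normedModType R.

(** The form of cay X to differentiate: X occurs once, and no product rule is
    needed. It comes from 1 + X = 2 - (1 - X). *)
Lemma cayE m (X : 'M[R]_m) : cay_defined X ->
  cay X = 2 *: invmx (1%:M - X) - 1%:M.
Proof.
move=> dX; rewrite /cay.
have -> : 1%:M + X = 2 *: 1%:M - (1%:M - X).
  by rewrite opprB addrCA scaler_nat mulr2n addrK addrC.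
by rewrite mulmxBl mulmxV // -scalemxAl mul1mx.
Qed.

Lemma cay0 m : cay (0 : 'M[R]_m) = 1%:M.
Proof. by rewrite /cay subr0 addr0 invmx1 mulmx1. Qed.

Lemma cay_defined0 m : cay_defined (0 : 'M[R]_m).
Proof. by rewrite /cay_defined subr0 unitmx1. Qed.

Lemma cay_mulVr m (X : 'M[R]_m) : cay_defined X -> cay_defined (- X) ->
  cay X *m cay (- X) = 1%:M.
Proof.
rewrite /cay_defined /cay opprK => dX dNX.
by rewrite mulmxA mulmxKV // mulmxV.
Qed.

Lemma diff_cay {V} m (f : V -> 'M[R]_m) x :
  differentiable f x -> cay_defined (f x) ->
  differentiable (fun y => cay (f y)) x /\
  forall v, 'D_v (fun y => cay (f y)) x =
    2 *: (invmx (1%:M - f x) *m 'D_v f x *m invmx (1%:M - f x)).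
Proof.
move=> df fx.
have dB : differentiable (fun y => 1%:M - f y) x by exact: differentiableB.
have DB v : 'D_v (fun y => 1%:M - f y) x = - 'D_v f x.
  by rewrite deriveB ?derive_cst ?sub0r //; exact: diff_derivable.
have [di Di] := diff_invmx dB fx.
have nE : \near x, 2 *: invmx (1%:M - f x) - 1%:M = cay (f x).
  have cB := differentiable_continuous dB.
  near=> y; rewrite cayE //; near: y.
  exact: cB (open_nbhs_nbhs (conj (@open_unitmx _ m) fx)).
have dE : differentiable (fun y => 2 *: invmx (1%:M - f y) - 1%:M) x.
  by apply: differentiableB => //; exact: differentiableZ.
split=> [|v]; first exact: near_eq_differentiable nE dE.
rewrite -(near_eq_derive _ nE) deriveB //.
- rewrite derive_cst subr0 deriveZ; last exact: diff_derivable.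
  by rewrite Di DB mulmxN mulNmx opprK.
- by apply: diff_derivable; exact: differentiableZ.
Unshelve. all: by end_near. Qed.

Lemma of_class_cay {V} m k (O : set V) (f : V -> 'M[R]_m) : open O ->
  (forall x, O x -> cay_defined (f x)) ->
  of_class k O f -> of_class k O (fun y => cay (f y)).
Proof.
move=> oO fO Cf; apply: of_class_mulmx => //.
  exact: of_classD (of_class_cst _ _ _) Cf.
apply: of_class_invmx => //; apply: (of_classD oO (of_class_cst k O 1%:M)).
exact: of_classN.
Qed.

Lemma open_cay_defined {V} n (f : V -> 'M[R]_n) :
  continuous f -> open [set x | cay_defined (f x)].
Proof.
move=> cf; apply: (@open_comp _ _ (fun x => 1%:M - f x) [set A | A \in unitmx]).
  move=> x _; apply: (@continuousB _ _ _ (cst 1%:M) f); last exact: cf.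
  exact: cst_continuous.
exact: open_unitmx.
Qed.

Lemma comm_mx_inv n (A B : 'M[R]_n) :
  B \in unitmx -> comm_mx A B -> comm_mx A (invmx B).
Proof.
move=> uB AB; apply: (can_inj (mulKmx uB)).
by rewrite mulmxA -AB mulmxK // mulKVmx.
Qed.

Lemma comm_mx_cay n (A X : 'M[R]_n) :
  cay_defined X -> comm_mx A X -> comm_mx A (cay X).
Proof.
move=> dX AX; apply: comm_mxM; first exact: comm_mxD (comm_mx1 _) _.
apply: comm_mx_inv => //; exact: comm_mxB (comm_mx1 _) _.
Qed.

Section Curve.
Variables (n : nat) (X Y : 'M[R]_n).
Hypotheses (XY : comm_mx Y X) (dX : cay_defined X) (dNX : cay_defined (- X)).
Let N := invmx (1%:M - X).
Let M := invmx (1%:M + X).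

Let uP : 1%:M + X \in unitmx.
Proof. by rewrite -[X]opprK. Qed.

(** With A := Y (N + M), the Cayley curve solves the linear equation C' = A C:
    the right-hand side is the derivative of cay in the direction Y, and it
    appears because M cancels the factor 1 + X of cay X, while N cay X is
    2 N^2 - N. *)
Lemma mul_cay : Y *m (N + M) *m cay X = 2 *: (N *m Y *m N).
Proof.
have YN : comm_mx Y N.
  by apply: comm_mx_inv => //; apply: comm_mxB (comm_mx1 _) _.
rewrite -mulmxA mulmxDl {2}/cay mulKmx // cayE // -/N mulmxBr -scalemxAr mulmx1.
by rewrite subrK -scalemxAr mulmxA YN.
Qed.

(** The same equation with the factors in the other order, as needed for the
    right factor cay (- X) of the retraction: all the matrices involved are
    rational expressions in X and Y, which commute. *)
Lemma cay_mul : cay X *m (Y *m (N + M)) = 2 *: (N *m Y *m N).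
Proof.
rewrite -mul_cay; apply/comm_mx_sym/comm_mx_cay => //; apply: comm_mx_sym.
apply: comm_mxM; first exact: comm_mx_sym.
apply: comm_mxD; apply: comm_mx_inv; rewrite ?uP //.
  by apply: comm_mxB => //; exact: comm_mx1.
by apply: comm_mxD => //; exact: comm_mx1.
Qed.

End Curve.

End Cayley.

(** * The symplectic adjoint *)

Section SymplecticAdjoint.
Context {R : realType}.

Lemma sympJ_tr a : (sympJ a)^T = - sympJ a :> 'M[R]_(a + a).
Proof.
by rewrite /sympJ tr_block_mx opp_block_mx !trmx0 !oppr0 linearN /= trmx1 opprK.
Qed.

Lemma sympJ_sqr a : sympJ a *m sympJ a = - 1%:M :> 'M[R]_(a + a).
Proof.
rewrite /sympJ mulmx_block !mul0mx !mulmx0 !mul1mx !mulmx1 !addr0 !add0r.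
by rewrite [in RHS]scalar_mx_block opp_block_mx !oppr0.
Qed.

Lemma spadjM a b c (A : 'M[R]_(a + a, b + b)) (B : 'M[R]_(b + b, c + c)) :
  spadj (A *m B) = spadj B *m spadj A.
Proof.
rewrite /spadj trmx_mul !mulmxA; congr (_ *m _ *m _).
by rewrite -[RHS]mulmxA (sympJ_tr b) mulmxN sympJ_sqr opprK mulmx1.
Qed.

Lemma spadjK a b (A : 'M[R]_(a + a, b + b)) : spadj (spadj A) = A.
Proof.
rewrite /spadj !trmx_mul !trmxK !mulmxA sympJ_tr mulmxN !mulNmx opprK.
by rewrite sympJ_sqr -mulmxA sympJ_sqr !mulNmx mulmxN mul1mx mulmx1 opprK.
Qed.

Lemma spadj_is_linear a b :
  linear (@spadj R a b : 'M[R]_(a + a, b + b) -> 'M[R]_(b + b, a + a)).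
Proof.
move=> c A B; rewrite /spadj linearP /= mulmxDr mulmxDl.
by rewrite -scalemxAr -scalemxAl.
Qed.
HB.instance Definition _ a b :=
  GRing.isLinear.Build R _ _ _ (@spadj R a b) (@spadj_is_linear a b).

Lemma spadj1 a : spadj (1%:M : 'M[R]_(a + a)) = 1%:M.
Proof. by rewrite /spadj trmx1 mulmx1 sympJ_tr mulNmx sympJ_sqr opprK. Qed.

Lemma spadj_unit a (A : 'M[R]_(a + a)) : A \in unitmx -> spadj A \in unitmx.
Proof.
move=> uA; suff /mulmx1_unit[] : spadj A *m spadj (invmx A) = 1%:M by [].
by rewrite -spadjM mulVmx // spadj1.
Qed.

Lemma spadj_invmx a (A : 'M[R]_(a + a)) : A \in unitmx ->
  spadj (invmx A) = invmx (spadj A).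
Proof.
move=> uA; apply: (can_inj (mulKmx (spadj_unit uA))).
by rewrite mulmxV ?spadj_unit // -spadjM mulVmx // spadj1.
Qed.

(** The Cayley transformation maps the Lie algebra to the symplectic group:
    together with [cay_mulVr] this gives (cay X)^+ = (cay X)^-1. *)
Lemma spadj_cay a (X : 'M[R]_(a + a)) : spadj X = - X -> cay_defined X ->
  cay_defined (- X) -> spadj (cay X) = cay (- X).
Proof.
move=> XN dX dNX; rewrite !cayE // linearB linearZ /= spadj1 spadj_invmx //.
by rewrite linearB /= spadj1 XN.
Qed.

End SymplecticAdjoint.

(** * Tangent vectors of the symplectic Grassmannian *)

Section Conjugation.
Context {R : realType}.

Lemma lieZl n c (A B : 'M[R]_n) : lie (c *: A) B = c *: lie A B.
Proof. by rewrite /lie -scalemxAl -scalemxAr scalerBr. Qed.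

Lemma lie0l n (B : 'M[R]_n) : lie 0 B = 0.
Proof. by rewrite /lie mul0mx mulmx0 subr0. Qed.

Lemma spadj_lie n (A B : 'M[R]_(n + n)) :
  spadj (lie A B) = lie (spadj B) (spadj A).
Proof. by rewrite /lie linearB /= !spadjM. Qed.

Lemma opp_lie n (A B : 'M[R]_n) : - lie A B = lie B A.
Proof. by rewrite /lie opprB. Qed.

Lemma SpGr_conj n k (C P : 'M[R]_(n + n)) :
  C *m spadj C = 1%:M -> SpGr n k P -> SpGr n k (C *m P *m spadj C).
Proof.
move=> CV [PP rP Padj]; have [uC uV] := mulmx1_unit CV.
split; last by rewrite spadjM spadjK spadjM Padj mulmxA.
  move: (spadj C) (mulmx1C CV) => D DC.
  by rewrite !mulmxA -(mulmxA _ D C) DC mulmx1 -(mulmxA C P P) PP.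
by rewrite mxrankMfree ?row_free_unit // eqmxMfull // row_full_unit.
Qed.

End Conjugation.

Section TangentVectors.
Context {R : realType}.
Variables (n k : nat) (P Gamma : 'M[R]_(n + n)).
Hypotheses (HP : SpGr n k P) (HG : TSpGr P Gamma).

Lemma TSpGr_spadj : spadj Gamma = Gamma.
Proof.
have [_ _ Padj] := HP; have [Om HOm ->] := HG; rewrite /spLie /= in HOm.
by rewrite spadj_lie HOm Padj /lie mulmxN mulNmx opprK addrC.
Qed.

(** A tangent vector is off-diagonal with respect to the splitting of the space
    into the image and the kernel of P. This is what makes Gamma U tangent to
    the Stiefel manifold at U. *)
Lemma TSpGr_sandwich : P *m Gamma *m P = 0.
Proof.
have [PP _ _] := HP; have [Om HOm ->] := HG.
by rewrite /lie mulmxBr mulmxBl !mulmxA PP -(mulmxA _ P P) PP subrr.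
Qed.

(** On off-diagonal Gamma one has Gamma P + P Gamma = Gamma, whence
    [[Gamma, P], P] = Gamma P - 2 P Gamma P + P Gamma = Gamma. *)
Lemma TSpGr_lieK : lie (lie Gamma P) P = Gamma.
Proof.
have [PP _ _] := HP; have PGP := TSpGr_sandwich.
have GE : Gamma *m P + P *m Gamma = Gamma.
  have [Om _ ->] := HG; rewrite /lie mulmxBl mulmxBr !mulmxA PP -(mulmxA Om) PP.
  by rewrite addrA subrK.
rewrite [LHS]/lie /lie mulmxBl mulmxBr !mulmxA PP PGP sub0r opprK.
by rewrite subr0 -mulmxA PP.
Qed.

Lemma spadj_lie_TSpGr c : spadj (c *: lie Gamma P) = - (c *: lie Gamma P).
Proof.
have [_ _ Padj] := HP.
by rewrite linearZ /= spadj_lie TSpGr_spadj Padj -opp_lie scalerN.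
Qed.

Lemma SpGr_retr_SpGr : retr_SpGr_dom n k (P, Gamma) ->
  SpGr n k (retr_SpGr P Gamma).
Proof.
move=> [_ /= dX dNX]; rewrite /retr_SpGr.
rewrite -spadj_cay ?spadj_lie_TSpGr //; apply: SpGr_conj => //.
by rewrite spadj_cay ?spadj_lie_TSpGr ?cay_mulVr.
Qed.

Variables (U : 'M[R]_(n + n, k + k)).
Hypotheses (HU : SpSt n k U) (rU : rho U = P).

(** Since U U^+ = P, both correction terms equal P Gamma P / 2 and cancel. *)
Lemma tildeOmega_hor_lift : tildeOmega U (hor_lift Gamma U) = lie Gamma P.
Proof.
have UP : U *m spadj U = P by exact: rU.
rewrite /tildeOmega /hor_lift spadjM TSpGr_spadj UP.
rewrite -(mulmxA _ (Gamma *m U)) -(mulmxA Gamma) UP (mulmxA U) UP.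
rewrite mulmxBl mul1mx mulmxBr mulmx1 -scalemxAl -scalemxAr (mulmxA P).
by rewrite opprB addrA subrK.
Qed.

(** As U = P U and U^+ = U^+ P, the matrix U^+ Gamma U contains
    P Gamma P = 0; so it even vanishes. *)
Lemma hor_lift_tangent : TSpSt U (hor_lift Gamma U).
Proof.
suff: spadj U *m hor_lift Gamma U = 0.
  by rewrite /TSpSt /spLie /= => ->; rewrite linear0 oppr0.
rewrite /hor_lift; have UU : spadj U *m U = 1%:M := HU.
have sE : spadj U = spadj U *m P by rewrite -rU /rho mulmxA UU mul1mx.
have UE : P *m U = U by rewrite -rU /rho -mulmxA UU mulmx1.
rewrite sE -{2}UE; move: (spadj U) => D.
rewrite -(mulmxA D) (mulmxA Gamma) (mulmxA P) (mulmxA P).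
by rewrite TSpGr_sandwich mul0mx mulmx0.
Qed.

Lemma retr_SpGr_rho : retr_SpGr_dom n k (P, Gamma) ->
  retr_SpGr P Gamma = rho (retr_SpSt U (hor_lift Gamma U)).
Proof.
move=> [_ /= dX dNX].
rewrite /rho /retr_SpSt tildeOmega_hor_lift spadjM.
rewrite spadj_cay ?spadj_lie_TSpGr //.
by rewrite /retr_SpGr -rU /rho !mulmxA.
Qed.

End TangentVectors.

(** * Derivatives of the retraction *)

Section Retraction.
Context {R : realType}.
Implicit Types V : normedModType R.

Lemma diff_half_lie {V} n (f : V -> 'M[R]_n) (P : 'M[R]_n) x :
  differentiable f x ->
  differentiable (fun y => 2^-1 *: lie (f y) P) x /\
  forall v, 'D_v (fun y => 2^-1 *: lie (f y) P) x = 2^-1 *: lie ('D_v f x) P.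
Proof.
move=> df; have dP : differentiable (cst P : V -> _) x by [].
have [dl Dl] := diff_mulmx df dP; have [dr Dr] := diff_mulmx dP df.
have dlie : differentiable (fun y => lie (f y) P) x by exact: differentiableB.
split=> [|v]; first exact: differentiableZ.
rewrite deriveZ; last exact: diff_derivable.
rewrite deriveB; [|exact: diff_derivable|exact: diff_derivable].
by rewrite Dl Dr derive_cst mulmx0 add0r mul0mx addr0.
Qed.

(** The argument of the retraction is an arbitrary map f since two cases are
    needed: the identity, for the differential at 0, and the line t |-> t Gamma,
    for the differential equation. *)
Lemma diff_retr_SpGr {V} n (f : V -> 'M[R]_(n + n)) (P : 'M[R]_(n + n)) x :
  let X := 2^-1 *: lie (f x) P in
  differentiable f x -> cay_defined X -> cay_defined (- X) ->
  differentiable (fun y => retr_SpGr P (f y)) x /\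
  forall v, let Y := 2^-1 *: lie ('D_v f x) P in
    let N := invmx (1%:M - X) in let M := invmx (1%:M + X) in
    'D_v (fun y => retr_SpGr P (f y)) x =
    2 *: (N *m Y *m N) *m P *m cay (- X) - cay X *m P *m (2 *: (M *m Y *m M)).
Proof.
move=> X df dX dNX.
have [dh Dh] := diff_half_lie P df.
have [dc Dc] := diff_cay dh dX.
have dNh : differentiable (fun y => - (2^-1 *: lie (f y) P)) x.
  exact: differentiableN.
have [dNc DNc] := diff_cay dNh dNX.
have dP : differentiable (cst P : V -> _) x by [].
have [dcP DcP] := diff_mulmx dc dP.
have [dR DR] := diff_mulmx dcP dNc.
split=> // v Y N M; rewrite /retr_SpGr DR DcP DNc Dc derive_cst mulmx0 add0r Dh.
rewrite deriveN; last exact: diff_derivable.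
by rewrite Dh opprK addrC mulmxN mulNmx scalerN mulmxN.
Qed.

Lemma is_derive_retr_curve n (P Gamma : 'M[R]_(n + n)) (t : R) :
  let Y := 2^-1 *: lie Gamma P in
  cay_defined (t *: Y) -> cay_defined (- (t *: Y)) ->
  is_derive t 1 (fun s : R => retr_SpGr P (s *: Gamma))
    (lie (Y *m (invmx (1%:M - t *: Y) + invmx (1%:M + t *: Y)))
         (retr_SpGr P (t *: Gamma))).
Proof.
move=> Y dX dNX.
have XE : 2^-1 *: lie (t *: Gamma) P = t *: Y.
  by rewrite lieZl !scalerA mulrC.
have df : differentiable (fun s : R => s *: Gamma) t.
  exact: differentiableZl.
have := diff_retr_SpGr (P := P) df; rewrite /= XE => /(_ dX dNX) [dR DR].
have D1 : 'D_1 (fun s : R => s *: Gamma) t = Gamma.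
  by rewrite deriveE // diffZl //= diff_val scale1r.
apply: DeriveDef; first exact: diff_derivable.
have YX : comm_mx Y (t *: Y).
  by move: (Y) => Z; rewrite /comm_mx -scalemxAl -scalemxAr.
have YNX : comm_mx Y (- (t *: Y)) by exact: comm_mxN.
have AC := mul_cay YX dX dNX.
have CA := cay_mul YNX dNX; rewrite !opprK in CA.
have {CA} := CA dX; rewrite [invmx _ + _]addrC => CA.
rewrite DR D1 /retr_SpGr XE -/Y -AC -CA.
move: (Y *m _) (cay _) (cay _) => A C D.
by rewrite /lie !mulmxA.
Qed.

End Retraction.

(** * The retraction on the symplectic Grassmannian *)

Section SmoothRetraction.
Context {R : realType}.
Variables n k : nat.
Local Notation mx := 'M[R]_(n + n).

Let X (PG : mx * mx) : mx := 2^-1 *: lie PG.2 PG.1.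

Let O : set (mx * mx) :=
  [set PG | cay_defined (X PG)] `&` [set PG | cay_defined (- X PG)].

Lemma of_class_half_lie j (S : set (mx * mx)) : open S -> of_class j S X.
Proof.
move=> oS.
have C1 : of_class j S (fst : mx * mx -> mx).
  by apply: of_class_linear => x; exact: cvg_fst.
have C2 : of_class j S (snd : mx * mx -> mx).
  by apply: of_class_linear => x; exact: cvg_snd.
apply: of_classZ => //; apply: of_classD => //.
  exact: of_class_mulmx.
by apply: of_classN => //; exact: of_class_mulmx.
Qed.

Lemma open_retr_dom : open O.
Proof.
have cX : continuous X by move=> x; exact: (of_class_half_lie 0 openT).
apply: openI; apply: open_cay_defined => // x.
by apply: continuousN; exact: cX.
Qed.

Lemma smooth_retr_SpGr :
  smooth_on (retr_SpGr_dom n k) (fun PG : mx * mx => retr_SpGr PG.1 PG.2).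
Proof.
move=> PG [_ dX dNX]; exists O; exists (fun PG => retr_SpGr PG.1 PG.2).
split=> //; first exact: open_retr_dom.
move=> j; have oO := open_retr_dom; have CX := of_class_half_lie j oO.
apply: of_class_mulmx => //.
  apply: of_class_mulmx => //.
    by apply: of_class_cay => // x [].
  by apply: of_class_linear => x; exact: cvg_fst.
by apply: of_class_cay => //; [move=> x [] | exact: of_classN].
Qed.

(** At 0 the formula of [diff_retr_SpGr] degenerates to [[V, P], P]. *)
Lemma retraction_SpGr :
  is_retraction (SpGr n k) (@TSpGr R n) (retr_SpGr_dom n k) (@retr_SpGr R n).
Proof.
have dom0 (P : mx) : SpGr n k P -> retr_SpGr_dom n k (P, 0).
  move=> HP; split=> /=.
  - split=> //=; exists 0; last by rewrite lie0l.
    by rewrite /spLie /= linear0 oppr0.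
  - by rewrite lie0l scaler0 cay_defined0.
  - by rewrite lie0l scaler0 oppr0 cay_defined0.
split=> //.
- exists O; first exact: open_retr_dom.
  by apply/seteqP; split=> [PG [? ? ?]|PG [? [? ?]]].
- exact: smooth_retr_SpGr.
- by move=> P v Hd; have [[HP Hv] _ _] := Hd; exact: SpGr_retr_SpGr.
move=> P HP; split.
  by rewrite /retr_SpGr lie0l scaler0 oppr0 cay0 mul1mx mulmx1.
have [_ dX dNX] := dom0 P HP.
have [|dR DR] := diff_retr_SpGr (f := id) _ dX dNX; first by [].
apply: has_diff0_on_derive => // v Tv.
rewrite DR /= lie0l scaler0 derive_id oppr0 addr0 invmx1 cay0.
rewrite !mul1mx !mulmx1 scalerA mulfV ?pnatr_eq0 // scale1r.
exact: TSpGr_lieK HP Tv.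
Qed.

End SmoothRetraction.

Theorem proposition5p5 (R : realType) (n k : nat)
    (k_gt0 : (0 < k)%N) (le_kn : (k <= n)%N) :
  is_retraction (SpGr n k) (@TSpGr R n) (retr_SpGr_dom n k) (@retr_SpGr R n) /\
  forall P Gamma : 'M[R]_(n + n), SpGr n k P -> TSpGr P Gamma ->
    (retr_SpGr_dom n k (P, Gamma) ->
     forall U : 'M[R]_(n + n, k + k), SpSt n k U -> rho U = P ->
       retr_SpSt_dom n k (U, hor_lift Gamma U) /\
       retr_SpGr P Gamma = rho (retr_SpSt U (hor_lift Gamma U))) /\
    (let gamma : R -> 'M[R]_(n + n) := fun t => retr_SpGr P (t *: Gamma) in
     forall t : R, retr_SpGr_dom n k (P, t *: Gamma) ->
       is_derive t 1 gamma
         (lie (2^-1 *: lie Gamma P *m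
                 (invmx (1%:M - (t / 2) *: lie Gamma P)
                  + invmx (1%:M + (t / 2) *: lie Gamma P)))
              (gamma t))).
Proof.
split; first exact: retraction_SpGr.
move=> P Gamma HP HG; split.
  move=> Hd U HU rU; split; last exact: retr_SpGr_rho Hd.
  have [_ dX _] := Hd; split=> /=; last by rewrite (tildeOmega_hor_lift HP).
  by split=> //; exact: (hor_lift_tangent HP HG HU rU).
move=> gamma t [_ dX dNX]; rewrite -!(scalerA t).
have XE : 2^-1 *: lie (t *: Gamma) P = t *: (2^-1 *: lie Gamma P).
  by rewrite lieZl !scalerA mulrC.
by apply: is_derive_retr_curve; rewrite -XE.
Qed.
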